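(* Let $C_0\ge 1$, $h\ge 0$ be fixed real numbers, let $s\ge 1$ be a fixed integer and let $\lambda_1,\dots,\lambda_s\ge 0$ be fixed real numbers. For each $n\ge 1$ let $X_1,\dots,X_n$ (whose joint distribution may depend on $n$) be 1-dependent, not necessarily identically distributed random variables taking values in the nonnegative integers with $X_i\le C_0$ for $1\le i\le n$. Let $S_n=X_1+\cdots+X_n$ and $F_n\{k\}=P(S_n=k)$. Let $\nu_j(k)=\mathrm{E}\,X_k(X_k-1)\cdots(X_k-j+1)$. Suppose that, as $n\to\infty$, $$\max_{1\le j\le n}\nu_1(j)\to 0,$$ $$\frac{1}{m!}\sum_{j=1}^n\nu_m(j)\to\sum_{l=m}^s\binom{l}{m}\lambda_l,\qquad m=1,2,\dots,s,$$ $$\sum_{j=1}^n\nu_{s+1}(j)\to 0,$$ $$\sum_{j=2}^n|\mathrm{Cov}(X_{j-1},X_j)|\to 0.$$ Then, as $n\to\infty$, $$\sum_{k=0}^\infty e^{hk}\,\bigl|F_n\{k\}-\mathrm{CP}(s,\lambda)\{k\}\bigr|\to 0.$$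
   Context: Random variables $X_1,\dots,X_n$ are 1-dependent if for all $1\le p<q\le n$ with $q-p>1$ the sigma-algebras generated by $X_1,\dots,X_p$ and by $X_q,\dots,X_n$ are independent. $\mathrm{CP}(s,\lambda)=\mathrm{CP}(s,\lambda_1,\dots,\lambda_s)$ is the compound Poisson distribution of $N_1+2N_2+\cdots+sN_s$, where $N_1,\dots,N_s$ are independent Poisson random variables with means $\lambda_1,\dots,\lambda_s$; $\mathrm{CP}(s,\lambda)\{k\}$ is the mass it assigns to $k$. *)

(* Defs.v *)
From HB Require Import structures.
From mathcomp Require Import all_boot all_order all_algebra.
From mathcomp Require Import all_classical all_reals all_analysis.

Set Implicit Arguments.
Unset Strict Implicit.
Unset Printing Implicit Defensive.

Import Order.TTheory GRing.Theory Num.Theory.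
Import numFieldNormedType.Exports.

Local Open Scope classical_set_scope.
Local Open Scope ring_scope.

Section dependence.
Context d (T : measurableType d) (R : realType) (P : probability T R).

Definition sigma_family (X : nat -> {RV P >-> nat}) (I : set nat) :
    set (set T) :=
  <<s \bigcup_(i in I) g_sigma_algebra_preimage (X i) >>.

Definition independent_systems (F G : set (set T)) : Prop :=
  forall A B, F A -> G B -> P (A `&` B) = (P A * P B)%E.

Definition one_dependent (n : nat) (X : nat -> {RV P >-> nat}) : Prop :=
  forall p q : nat, (1 <= p)%N -> (p < q)%N -> (q <= n)%N -> (1 < q - p)%N ->
  independent_systems (sigma_family X [set i | (1 <= i <= p)%N])
                      (sigma_family X [set i | (q <= i <= n)%N]).

Definition factorial_moment (m : nat) (X : {RV P >-> nat}) : \bar R :=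
  'E_P[fun w => (X w ^_ m)%:R].

Definition natcov (X Y : {RV P >-> nat}) : \bar R :=
  covariance P (fun w => (X w)%:R) (fun w => (Y w)%:R).

End dependence.

Lemma measurable_nat_pair (f : nat * nat -> nat) : measurable_fun setT f.
Proof.
move=> _ B _; apply: countable_measurable => [[a b]|]; last exact: countableP.
rewrite (_ : [set (a, b)] = [set a] `*` [set b]); first exact: measurableX.
by apply/seteqP; split => [_ -> | [x y] [/= -> ->]].
Qed.

Definition add_scaled (j : nat) (x : nat * nat) : nat := (x.1 + j * x.2)%N.

HB.instance Definition _ (j : nat) :=
  isMeasurableFun.Build _ _ _ _ (add_scaled j)
    (measurable_nat_pair (add_scaled j)).

(* [poisson_prob] ignores its second argument, and [poisson_prob 0] is the
   point mass at 0, i.e. the Poisson distribution with mean 0. *)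
Definition poisson (R : realType) (mean : R) : probability nat R :=
  poisson_prob mean 0%N.

(* The distribution of N_1 + 2 N_2 + ... + s N_s for independent N_j with
   Poisson distributions of means lam j: independence of N_1 + ... + s N_s and
   N_(s+1) is the product measure. Only lam 1, ..., lam s matter. *)
Fixpoint CP (R : realType) (s : nat) (lam : nat -> R) : probability nat R :=
  if s is s'.+1 then
    distribution (CP s' lam \x poisson (lam s))%E (add_scaled s)
  else \d_0%N.

(* Main.v *)
(* Write g_j = E z^(S_j) for fixed 0 < z < 1. Since S_(j-2) is independent of
   X_j, expanding the last two factors of z^(S_j) gives
     g_j = g_(j-1) - g_(j-2) E(1 - z^X_j)
           + E(z^(S_(j-2)) (1 - z^X_(j-1)) (1 - z^X_j)),
   so g_j = g_(j-1) exp(-E(1 - z^X_j)) up to an error of order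
   nu_1(j-1) nu_1(j) + nu_1(j)^2 + |Cov(X_(j-1), X_j)|. These errors sum to o(1),
   and the sum of E(1 - z^X_j) converges to -log of the generating function of
   CP(s, lambda) by expanding z^X_j in factorial moments. Hence the generating
   functions converge on (0, 1), and so do the masses, by induction on k. The
   same device bounds E u^(S_j) by E u^(S_(j-1)) (1 + u^(2M) nu_1(j)) for u >= 1,
   so the exponential moments are bounded and the tails of the weighted series
   are uniformly small. *)
Require Import Defs.
From HB Require Import structures.
From mathcomp Require Import all_boot all_order all_algebra.
From mathcomp Require Import all_classical all_reals all_analysis.
From mathcomp Require Import measurable_realfun ring lra.

Set Implicit Arguments.
Unset Strict Implicit.
Unset Printing Implicit Defensive.

Import Order.TTheory GRing.Theory Num.Theory.
Import numFieldNormedType.Exports.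

Local Open Scope classical_set_scope.
Local Open Scope ring_scope.

(** * Measures on the naturals and the generating function of [CP] *)

Section nat_measures.
Context (R : realType).
Implicit Types (z r : R) (lam : nat -> R).

Lemma measurable_fun_nat d (T : measurableType d) (f : nat -> T) :
  measurable_fun setT f.
Proof. by []. Qed.

(** The singletons partition [nat], and the integrand is constant on each of them. *)
Lemma ge0_integral_nat (mu : {measure set nat -> \bar R}) (f : nat -> \bar R) :
  (forall k, 0 <= f k)%E ->
  (\int[mu]_k f k = \sum_(0 <= k <oo) f k * mu [set k])%E.
Proof.
move=> f0; rewrite -[in LHS](_ : \bigcup_k [set k] = [set: nat]); last first.
  by apply/seteqP; split => // k _; exists k.
rewrite ge0_integral_bigcup//.
- apply: eq_eseriesr => k _.
  transitivity (\int[mu]_(x in [set k]) (cst (f k)) x)%E.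
    by apply: eq_integral => x; rewrite inE => ->.
  by rewrite integral_cst.
- by move=> i j _ _ [x [/= -> ->]].
Qed.

Lemma poisson_pgf r z : 0 <= r -> 0 <= z ->
  (\int[poisson r]_k (z ^+ k)%:E = (expR (r * (z - 1)))%:E)%E.
Proof.
move=> r0 z0; rewrite ge0_integral_nat; last first.
  by move=> k; rewrite lee_fin exprn_ge0.
(* Mean 0 is a separate branch of [poisson_prob], the point mass at 0; there both sides equal 1. *)
have [r_gt0|] := ltP 0 r; last first.
  move=> rle0; have -> : r = 0 by apply/eqP; rewrite eq_le r0 rle0.
  rewrite mul0r expR0 -ge0_integral_nat; last first.
    by move=> k; rewrite lee_fin exprn_ge0.
  rewrite (eq_measure_integral (\d_0%N : measure _ R)); last first.
    by move=> A _ _; rewrite /poisson/= /poisson_prob ltxx.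
  by rewrite integral_dirac//= diracT mul1e.
have -> : expR (r * (z - 1)) = expR (- r) * expR (r * z).
  by rewrite -expRD; congr expR; ring.
under eq_eseriesr.
  move=> k _.
  have -> : ((z ^+ k)%:E * poisson r [set k] =
             (expR (- r))%:E * (k`!%:R^-1 * (r * z) ^+ k)%:E)%E.
    rewrite /poisson/= /poisson_prob r_gt0 esum_set1; last first.
      by rewrite lee_fin poisson_pmf_ge0.
    by rewrite /poisson_pmf r_gt0 -!EFinM exprMn; congr EFin; ring.
  over.
rewrite /= nneseriesZl/=; last first.
  by move=> k _; rewrite lee_fin mulr_ge0// exprn_ge0// mulr_ge0.
rewrite EFinM; congr *%E; rewrite expRE -EFin_lim; last first.
  rewrite /pseries/=; under eq_fun do rewrite mulrC.
  exact: is_cvg_series_exp_coeff.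
by apply/congr_lim/funext => n/=; rewrite /pseries/= /series/= -sumEFin.
Qed.

(** Induction on [s]: by Tonelli the product measure factors the generating function, and the new
    Poisson variable, scaled by [s.+1], contributes its own generating function taken at
    [z ^+ s.+1]. *)
Lemma CP_pgf s lam z : (forall j, (1 <= j <= s)%N -> 0 <= lam j) -> 0 <= z ->
  (\int[CP s lam]_k (z ^+ k)%:E =
    (expR (\sum_(1 <= l < s.+1) lam l * (z ^+ l - 1)))%:E)%E.
Proof.
move=> + z0; elim: s => [lam0|s IH lam0] /=.
  by rewrite big_geq// expR0 integral_dirac// diracT mul1e.
rewrite ge0_integral_distribution//=; last first.
  by move=> k; rewrite lee_fin exprn_ge0.
rewrite fubini_tonelli1//=; last 2 first.
- apply/measurable_EFinP.
  apply: (measurableT_comp (measurable_fun_nat (fun k => z ^+ k))).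
  exact: measurable_nat_pair.
- by move=> k; rewrite lee_fin exprn_ge0.
rewrite /fubini_F/=.
under eq_integral.
  move=> x _.
  have -> : (\int[poisson (lam s.+1)]_y (z ^+ add_scaled s.+1 (x, y))%:E =
     (z ^+ x)%:E * (expR (lam s.+1 * (z ^+ s.+1 - 1)))%:E)%E.
    rewrite -poisson_pgf ?lam0 ?ltnSn// ?exprn_ge0//.
    rewrite -ge0_integralZl//; last 2 first.
    - by move=> y _; rewrite lee_fin !exprn_ge0.
    - by rewrite lee_fin exprn_ge0.
    by apply: eq_integral => y _; rewrite -EFinM -exprM -exprD.
  over.
rewrite ge0_integralZr//=; last first.
  by move=> x _; rewrite lee_fin exprn_ge0.
rewrite IH; last by move=> j /andP[j1 js]; rewrite lam0// j1 ltnW.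
by rewrite -EFinM -expRD [in RHS]big_nat_recr.
Qed.
End nat_measures.

(** * From generating functions to masses and to weighted sums *)

Section mass_convergence.
Context (R : realType).
Implicit Types (p q : nat -> R) (z u B : R).

(** The bound with [e = 1] makes the values eventually finite; the rest is the real criterion. *)
Lemma ge0_cvge0 (F : nat -> \bar R) : (forall n, (0 <= F n)%E) ->
  (forall e : R, 0 < e -> \forall n \near \oo, (F n <= e%:E)%E) ->
  F n @[n --> \oo] --> 0%E.
Proof.
move=> F0 Fe; apply/fine_cvgP; split.
  near=> n; rewrite ge0_fin_numE//.
  apply: (@le_lt_trans _ _ 1%E); last exact: ltry.
  by near: n; exact: Fe.
apply/cvgr0Pnorm_le => e e0; near=> n => /=.
have Fne : (F n <= e%:E)%E by near: n; exact: Fe.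
rewrite ger0_norm ?fine_ge0// -lee_fin fineK//.
by rewrite ge0_fin_numE// (le_lt_trans Fne)// ltry.
Unshelve. all: by end_near. Qed.

Lemma nneseries_tail_le (f g : nat -> R) (c : R) k :
  (forall i, 0 <= f i) -> (forall i, 0 <= g i) -> 0 <= c ->
  (forall i, (k <= i)%N -> f i <= c * g i) ->
  (\sum_(k <= i <oo) (f i)%:E <= c%:E * \sum_(0 <= i <oo) (g i)%:E)%E.
Proof.
move=> f0 g0 c0 fg; rewrite -nneseries_addn; last by move=> i; rewrite lee_fin.
apply: (@le_trans _ _ (\sum_(0 <= i <oo) c%:E * (g (i + k)%N)%:E)%E).
  apply: lee_nneseries => [i _ _|i _]; first by rewrite lee_fin.
  by rewrite -EFinM lee_fin fg// leq_addl.
rewrite nneseriesZl; last by move=> i _; rewrite lee_fin.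
rewrite lee_wpmul2l ?lee_fin//.
rewrite (nneseries_addn (f := fun i => (g i)%:E)); last first.
  by move=> i; rewrite lee_fin.
rewrite [leRHS](nneseries_split 0 k); last by move=> i _; rewrite lee_fin.
by rewrite add0n leeDr// sume_ge0// => i _; rewrite lee_fin.
Qed.

Lemma cvg_sum_nat m n (f : nat -> nat -> R) (l : nat -> R) :
  (forall i, (m <= i < n)%N -> f i x @[x --> \oo] --> l i) ->
  \sum_(m <= i < n) f i x @[x --> \oo] --> \sum_(m <= i < n) l i.
Proof.
move=> fl; rewrite big_nat; under eq_fun do rewrite big_nat.
by apply: cvg_big => //; exact: add_continuous.
Qed.

Lemma pgf_ge_partial p g z k : (forall i, 0 <= p i) -> 0 <= z ->
  (\sum_(0 <= i <oo) (z ^+ i * p i)%:E = g%:E)%E ->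
  \sum_(0 <= i < k) z ^+ i * p i <= g.
Proof.
move=> p0 z0 gE; rewrite -lee_fin -gE -sumEFin; apply: nneseries_lim_ge.
by move=> i _; rewrite lee_fin mulr_ge0// exprn_ge0.
Qed.

(** From index [k] on, [z ^+ i <= z ^+ k], and the total mass is at most 1. Together with
    [pgf_ge_partial] this brackets [g] up to [z ^+ k]. *)
Lemma pgf_le_partial p g z k : (forall i, 0 <= p i) -> 0 <= z <= 1 ->
  (\sum_(0 <= i <oo) (p i)%:E <= 1)%E ->
  (\sum_(0 <= i <oo) (z ^+ i * p i)%:E = g%:E)%E ->
  g <= \sum_(0 <= i < k) z ^+ i * p i + z ^+ k.
Proof.
move=> p0 /andP[z0 z1] p1 gE; rewrite -lee_fin -gE EFinD -sumEFin.
rewrite (nneseries_split 0 k); last first.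
  by move=> i _; rewrite lee_fin mulr_ge0// exprn_ge0.
rewrite add0n leeD2l//.
apply: (@le_trans _ _ ((z ^+ k)%:E * \sum_(0 <= i <oo) (p i)%:E)%E).
  apply: nneseries_tail_le => // [i||i ki].
  - by rewrite mulr_ge0// exprn_ge0.
  - exact: exprn_ge0.
  - by rewrite ler_wpM2r// ler_wiXn2l.
by rewrite -[leRHS]mule1 lee_wpmul2l// lee_fin exprn_ge0.
Qed.

(** Strong induction on [k]: once the masses below [k] are subtracted, the generating function is
    [z ^+ k] times the [k]-th mass up to [z ^+ k.+1]. Dividing by [z ^+ k] leaves an error [z],
    which is as small as desired. *)
Lemma pgf_cvg_mass (p : nat -> nat -> R) q (g : nat -> R -> R) (g0 : R -> R) :
  (forall n i, 0 <= p n i) -> (forall i, 0 <= q i) ->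
  (forall n, \sum_(0 <= i <oo) (p n i)%:E <= 1)%E ->
  (\sum_(0 <= i <oo) (q i)%:E <= 1)%E ->
  (forall n z, 0 < z < 1 ->
    (\sum_(0 <= i <oo) (z ^+ i * p n i)%:E)%E = (g n z)%:E) ->
  (forall z, 0 < z < 1 ->
    (\sum_(0 <= i <oo) (z ^+ i * q i)%:E)%E = (g0 z)%:E) ->
  (forall z, 0 < z < 1 -> g n z @[n --> \oo] --> g0 z) ->
  forall k, p n k @[n --> \oo] --> q k.
Proof.
move=> p0 q0 p1 q1 gE g0E gcvg; elim/ltn_ind => k IH.
apply/cvgrPdist_le => e e0.
(* The first bound makes the remainder [z ^+ k * z] cost at most half of [e]; the second keeps [z]
   below 1. *)
pose z := Num.min (e / 2) (1 / 2).
have z0 : 0 < z by rewrite lt_min !divr_gt0.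
have ze : z <= e / 2 by rewrite ge_min lexx.
have z1 : z < 1.
  by rewrite (@le_lt_trans _ _ (1 / 2))// ?ge_min ?lexx ?orbT//; lra.
have z01 : 0 < z < 1 by rewrite z0.
have z01' : 0 <= z <= 1 by rewrite !ltW.
have zk0 : 0 < z ^+ k by rewrite exprn_gt0.
have Dcvg : g n z - \sum_(0 <= i < k) z ^+ i * p n i @[n --> \oo] -->
    g0 z - \sum_(0 <= i < k) z ^+ i * q i.
  apply: cvgB; first exact: gcvg.
  apply: (cvg_sum_nat (f := fun i n => z ^+ i * p n i)) => i /= ik.
  by apply: cvgM; [exact: cvg_cst|exact: IH].
near=> n.
have : `|(g0 z - \sum_(0 <= i < k) z ^+ i * q i) -
         (g n z - \sum_(0 <= i < k) z ^+ i * p n i)| <= z ^+ k * (e / 2).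
  near: n; move/cvgrPdist_le : Dcvg; apply.
  by rewrite mulr_gt0// divr_gt0.
(* Truncation at [k.+1] keeps the [k]-th mass in the partial sum. *)
have := pgf_ge_partial k.+1 (p0 n) (ltW z0) (gE n _ z01).
have := pgf_ge_partial k.+1 q0 (ltW z0) (g0E _ z01).
have := pgf_le_partial k.+1 (p0 n) z01' (p1 n) (gE n _ z01).
have := pgf_le_partial k.+1 q0 z01' q1 (g0E _ z01).
rewrite !big_nat_recr//= exprSr.
set a := \sum_(0 <= i < k) z ^+ i * q i.
set b := \sum_(0 <= i < k) z ^+ i * p n i.
move=> h1 h2 h3 h4; rewrite ler_norml => /andP[h5 h6].
have h7 : z ^+ k * z <= z ^+ k * (e / 2) by rewrite ler_wpM2l// ltW.
rewrite ler_norml; apply/andP.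
by split; rewrite -(ler_pM2l zk0) ?mulrN mulrBr; lra.
Unshelve. all: by end_near. Qed.

(** Since [u ^+ i] is [2^-1 ^+ i * (2 * u) ^+ i], the moments at base [2 * u] bound the tail from
    [K] on by [2^-1 ^+ K * (B + B)], eventually uniformly in [n]. The head is a finite sum of null
    sequences. *)
Lemma weighted_mass_cvg (p : nat -> nat -> R) q u B : 0 <= u ->
  (forall n i, 0 <= p n i) -> (forall i, 0 <= q i) ->
  (\forall n \near \oo,
    (\sum_(0 <= i <oo) ((2 * u) ^+ i * p n i)%:E <= B%:E)%E) ->
  (\sum_(0 <= i <oo) ((2 * u) ^+ i * q i)%:E <= B%:E)%E ->
  (forall k, p n k @[n --> \oo] --> q k) ->
  (\sum_(0 <= i <oo) (u ^+ i * `|p n i - q i|)%:E)%E @[n --> \oo] --> 0%E.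
Proof.
move=> u0 p0 q0 pB qB pq; apply: ge0_cvge0.
  move=> n; apply: nneseries_ge0 => i _ _.
  by rewrite lee_fin mulr_ge0// exprn_ge0.
have B0 : 0 <= B.
  rewrite -lee_fin (le_trans _ qB)//.
  apply: nneseries_ge0 => i _ _.
  by rewrite lee_fin mulr_ge0// exprn_ge0// mulr_ge0.
move=> e e0.
have [K KB] : exists K : nat, 2^-1 ^+ K * (B + B) <= e / 2.
  exists (Num.bound ((B + B) / (e / 2))).
  set K := Num.bound _.
  have KB : (B + B) / (e / 2) <= 2 ^+ K.
    rewrite (@le_trans _ _ K%:R)//.
      by rewrite ltW// archi_boundP// divr_ge0 ?addr_ge0// divr_ge0// ltW.
    (* The Archimedean bound suffices as an exponent because [K < 2 ^ K]. *)
    by rewrite -natrX ler_nat ltnW// ltn_expl.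
  rewrite exprVn mulrC ler_pdivrMr ?exprn_gt0//.
  by rewrite mulrC -ler_pdivrMr// divr_gt0.
have headcvg : \sum_(0 <= i < K) u ^+ i * `|p n i - q i| @[n --> \oo] -->
    (0 : R).
  rewrite [X in _ --> X](_ : 0 =
    \sum_(0 <= i < K) u ^+ i * `|q i - q i|); last first.
    by rewrite big1// => i _; rewrite subrr normr0 mulr0.
  apply: (cvg_sum_nat (f := fun i n => u ^+ i * `|p n i - q i|)) => i _.
  apply: cvgM; first exact: cvg_cst.
  by apply: cvg_norm; apply: cvgB; [exact: pq|exact: cvg_cst].
near=> n.
have head : \sum_(0 <= i < K) u ^+ i * `|p n i - q i| <= e / 2.
  rewrite (le_trans (ler_norm _))//; near: n.
  by move/cvgr0Pnorm_le : headcvg; apply; rewrite divr_gt0.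
have pnB : (\sum_(0 <= i <oo) ((2 * u) ^+ i * p n i)%:E <= B%:E)%E.
  by near: n.
have t0 (i : nat) (x : R) : 0 <= x -> (0 <= ((2 * u) ^+ i * x)%:E)%E.
  by move=> x0; rewrite lee_fin mulr_ge0// exprn_ge0// mulr_ge0.
rewrite (nneseries_split 0 K); last first.
  by move=> i _; rewrite lee_fin mulr_ge0// exprn_ge0.
rewrite add0n sumEFin (splitr e) EFinD leeD ?lee_fin//.
rewrite (@le_trans _ _ (2^-1 ^+ K * (B + B))%:E)// ?lee_fin//.
apply: (@le_trans _ _ ((2^-1 ^+ K)%:E *
    \sum_(0 <= i <oo) ((2 * u) ^+ i * p n i + (2 * u) ^+ i * q i)%:E)%E).
  apply: nneseries_tail_le => [i|i||i Ki].
  - by rewrite mulr_ge0// exprn_ge0.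
  - by rewrite addr_ge0// -lee_fin t0.
  - by rewrite exprn_ge0.
  rewrite -mulrDr mulrA ler_pM ?exprn_ge0//.
    rewrite exprMn mulrA ler_peMl ?exprn_ge0//.
    by rewrite exprVn ler_pdivlMl ?exprn_gt0// mulr1 ler_weXn2l// ler1n.
  by rewrite (le_trans (ler_normB _ _))// !ger0_norm.
rewrite EFinM lee_wpmul2l ?lee_fin ?exprn_ge0//.
under eq_eseriesr do rewrite EFinD.
by rewrite nneseriesD ?EFinD ?leeD// => i _ _; exact: t0.
Unshelve. all: by end_near. Qed.
End mass_convergence.

(** * Expectations of bounded variables and products of independent ones *)

Section bounded_expectation.
Context d (T : measurableType d) (R : realType) (P : probability T R).
Implicit Types (f g : T -> R) (Y U V : T -> nat).

(** A class closed under sums, differences and products and integrable for a probability, from which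
    the integrability side conditions below follow. *)
Definition bounded_rv f :=
  measurable_fun setT f /\ exists c : R, forall w, `|f w| <= c.

Lemma bounded_rv_integrable f :
  bounded_rv f -> P.-integrable setT (EFin \o f).
Proof.
move=> [mf [c fc]]; apply: measurable_bounded_integrable => //.
  by apply: (le_lt_trans (probability_le1 P measurableT)); exact: ltry.
exists c; split; first exact: num_real.
by move=> x cx w _; exact: le_trans (fc w) (ltW cx).
Qed.

Lemma bounded_rvD f g :
  bounded_rv f -> bounded_rv g -> bounded_rv (fun w => f w + g w).
Proof.
move=> [mf [a fa]] [mg [b gb]]; split; first exact: measurable_funD.
by exists (a + b) => w; rewrite (le_trans (ler_normD _ _))// lerD.
Qed.

Lemma bounded_rvM f g :
  bounded_rv f -> bounded_rv g -> bounded_rv (fun w => f w * g w).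
Proof.
move=> [mf [a fa]] [mg [b gb]]; split; first exact: measurable_funM.
by exists (a * b) => w; rewrite normrM ler_pM.
Qed.

Lemma bounded_rv_cst (c : R) : bounded_rv (fun=> c).
Proof. by split => //; exists `|c|. Qed.

Lemma bounded_rvB f g :
  bounded_rv f -> bounded_rv g -> bounded_rv (fun w => f w - g w).
Proof.
move=> [mf [a fa]] [mg [b gb]]; split; first exact: measurable_funB.
by exists (a + b) => w; rewrite (le_trans (ler_normB _ _))// lerD.
Qed.

Lemma bounded_rv_nat Y N (g : nat -> R) : measurable_fun setT Y ->
  (forall w, (Y w <= N)%N) -> bounded_rv (fun w => g (Y w)).
Proof.
move=> mY YN; split.
  exact: (measurableT_comp (measurable_fun_nat g) mY).
(* A crude bound: [g (Y w)] is one of [g 0], ..., [g N]. *)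
exists (\sum_(0 <= a < N.+1) `|g a|) => w.
rewrite big_mkord (bigD1 (Ordinal (YN w : (Y w < N.+1)%N)))//= lerDl.
by rewrite sumr_ge0.
Qed.

Lemma Rintegral_prob_cst (c : R) : \int[P]_w c = c.
Proof. by have := expectation_cst P c; rewrite unlock /Rintegral => ->. Qed.

(** Boundedness of the sum is proved along with linearity because the induction needs the remaining
    sum to be integrable. *)
Lemma Rintegral_sum_seq (I : eqType) (r : seq I) (F : I -> T -> R) :
  (forall i, i \in r -> bounded_rv (F i)) ->
  bounded_rv (fun w => \sum_(i <- r) F i w) /\
  \int[P]_w (\sum_(i <- r) F i w) = \sum_(i <- r) \int[P]_w F i w.
Proof.
elim: r => [_|i r IH rF].
  under eq_fun do rewrite big_nil.
  split; first exact: bounded_rv_cst.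
  by rewrite big_nil Rintegral_prob_cst.
have [bS SE] : bounded_rv (fun w => \sum_(i <- r) F i w) /\
    \int[P]_w (\sum_(i <- r) F i w) = \sum_(i <- r) \int[P]_w F i w.
  by apply: IH => j jr; apply: rF; rewrite inE jr orbT.
have bF : bounded_rv (F i) by apply: rF; rewrite mem_head.
under eq_fun do rewrite big_cons.
rewrite big_cons; split; first exact: bounded_rvD.
by rewrite RintegralD ?SE//; exact: bounded_rv_integrable.
Qed.

Lemma nat_rv_expand Y N (g : nat -> R) w : (Y w <= N)%N ->
  g (Y w) = \sum_(a <- index_iota 0 N.+1) g a * \1_(Y @^-1` [set a]) w.
Proof.
move=> YN; rewrite (bigD1_seq (Y w)) ?iota_uniq ?mem_index_iota//=.
rewrite indicE mem_set// mulr1 big1 ?addr0// => a aY.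
by rewrite indicE memNset ?mulr0//= => /eqP; rewrite eq_sym (negbTE aY).
Qed.

Lemma measurable_nat_fiber Y a : measurable_fun setT Y ->
  measurable (Y @^-1` [set a]).
Proof. by move=> mY; rewrite -[_ @^-1` _]setTI; exact: mY. Qed.

Lemma Rintegral_indic_prob A : measurable A -> \int[P]_w \1_A w = fine (P A).
Proof. by move=> mA; rewrite /Rintegral integral_indic// setIT. Qed.

Lemma bounded_rv_indic A : measurable A -> bounded_rv \1_A.
Proof.
move=> mA; split => //; exists 1 => w.
by rewrite indicE; case: (_ \in _); rewrite ?normr1 ?normr0.
Qed.

(** Both variables take finitely many values, so each side becomes a double sum over fibers by
    [nat_rv_expand], and the hypothesis matches the terms. *)
Lemma Rintegral_indep U V N (f g : nat -> R) :
  measurable_fun setT U -> measurable_fun setT V ->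
  (forall w, (U w <= N)%N) -> (forall w, (V w <= N)%N) ->
  (forall a b, P (U @^-1` [set a] `&` V @^-1` [set b]) =
               (P (U @^-1` [set a]) * P (V @^-1` [set b]))%E) ->
  \int[P]_w (f (U w) * g (V w)) =
    \int[P]_w f (U w) * \int[P]_w g (V w).
Proof.
move=> mU mV UN VN UV.
have bI Y a (c : R) : measurable_fun setT Y ->
    bounded_rv (fun w => c * \1_(Y @^-1` [set a]) w).
  move=> mY; apply: bounded_rvM; first exact: bounded_rv_cst.
  by apply: bounded_rv_indic; exact: measurable_nat_fiber.
have fE Y (h : nat -> R) : measurable_fun setT Y -> (forall w, (Y w <= N)%N) ->
    \int[P]_w h (Y w) = \sum_(a <- index_iota 0 N.+1)
      h a * fine (P (Y @^-1` [set a])).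
  move=> mY YN; under eq_Rintegral do rewrite (nat_rv_expand h (YN _)).
  have [|_ ->] := Rintegral_sum_seq (r := index_iota 0 N.+1)
    (F := fun a w => h a * \1_(Y @^-1` [set a]) w).
    by move=> a _; exact: bI.
  apply: eq_bigr => a _; rewrite RintegralZl//.
    by rewrite Rintegral_indic_prob//; exact: measurable_nat_fiber.
  apply: bounded_rv_integrable; apply: bounded_rv_indic.
  exact: measurable_nat_fiber.
have bgV : bounded_rv (fun w => g (V w)) by exact: bounded_rv_nat VN.
rewrite (fE U f)//.
under eq_Rintegral do rewrite (nat_rv_expand f (UN _)) mulr_suml.
have [|_ ->] := Rintegral_sum_seq (r := index_iota 0 N.+1)
    (F := fun a w => f a * \1_(U @^-1` [set a]) w * g (V w)).
  by move=> a _; apply: bounded_rvM => //; exact: bI.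
rewrite mulr_suml; apply: eq_bigr => a _.
rewrite (fE V g)// mulr_sumr.
under eq_Rintegral do rewrite (nat_rv_expand g (VN _)) mulr_sumr.
have [|_ ->] := Rintegral_sum_seq (r := index_iota 0 N.+1)
    (F := fun b w => f a * \1_(U @^-1` [set a]) w *
                     (g b * \1_(V @^-1` [set b]) w)).
  by move=> b _; apply: bounded_rvM; exact: bI.
apply: eq_bigr => b _.
have mUV : measurable (U @^-1` [set a] `&` V @^-1` [set b]).
  by apply: measurableI; exact: measurable_nat_fiber.
transitivity (\int[P]_w (f a * g b *
    \1_(U @^-1` [set a] `&` V @^-1` [set b]) w)).
  by apply: eq_Rintegral => w _; rewrite indicI/=; ring.
rewrite RintegralZl//; last first.
  by apply: bounded_rv_integrable; exact: bounded_rv_indic.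
rewrite Rintegral_indic_prob// UV fineM ?fin_num_measure//; try ring;
  exact: measurable_nat_fiber.
Qed.

End bounded_expectation.

(** * Sums and the sigma-algebras generated by their terms *)

Lemma measurable_sum_nat d (T : measurableType d) (X : nat -> T -> nat)
    (r : seq nat) : (forall i, i \in r -> measurable_fun setT (X i)) ->
  measurable_fun setT (fun w => (\sum_(i <- r) X i w)%N).
Proof.
elim: r => [_|i r IH mX].
  by under eq_fun do rewrite big_nil; exact: measurable_cst.
under eq_fun do rewrite big_cons.
apply: (measurableT_comp (measurable_nat_pair (fun x => x.1 + x.2)%N)
  (g := fun w => (X i w, \sum_(i <- r) X i w)%N)).
apply: measurable_fun_pair; first by apply: mX; rewrite mem_head.
by apply: IH => j jr; apply: mX; rewrite inE jr orbT.
Qed.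

(** Equip the sample space with the sigma-algebra generated by the family: each [X i] is measurable
    for it by construction, hence so is the sum. *)
Lemma sigma_family_sum d (T : measurableType d) (R : realType)
    (P : probability T R) (X : nat -> {RV P >-> nat}) (I : set nat)
    (r : seq nat) (a : nat) : (forall i, i \in r -> I i) ->
  sigma_family X I [set w | (\sum_(i <- r) X i w)%N = a].
Proof.
move=> rI.
pose G := \bigcup_(i in I) g_sigma_algebra_preimage (X i).
suff mS : measurable_fun [set: g_sigma_algebraType G]
    (fun w : g_sigma_algebraType G => (\sum_(i <- r) X i w)%N).
  by have := mS measurableT [set a]; rewrite setTI; apply.
apply: measurable_sum_nat => i ir _ B mB; rewrite setTI.
apply: sub_sigma_algebra; exists i; first exact: rI.
by exists B; rewrite ?setTI.
Qed.

(** * Partial sums of a bounded 1-dependent sequence *)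

Section one_dependent_sums.
Context d (T : measurableType d) (R : realType) (P : probability T R).
Context (X : nat -> {RV P >-> nat}) (n M : nat).
Context (XM : forall i w, (1 <= i <= n)%N -> (X i w <= M)%N)
        (Xdep : (1 <= n)%N -> one_dependent n X).

Let S j w := (\sum_(1 <= i < j.+1) X i w)%N.
Let nu j : R := \int[P]_w (X j w)%:R.
(** The covariance of neighbours; it is meant for [j >= 2], where all sums of it start. *)
Let xcov j : R := \int[P]_w ((X j.-1 w)%:R * (X j w)%:R) - nu j.-1 * nu j.

Lemma partial_sum_measurable j : measurable_fun setT (S j).
Proof. by apply: measurable_sum_nat => i _; exact: measurable_funPT. Qed.

Lemma partial_sum_le j w : (j <= n)%N -> (S j w <= n * M)%N.
Proof.
move=> jn; rewrite /S.
apply: (@leq_trans (\sum_(1 <= i < j.+1) M)%N).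
  rewrite big_nat [leqRHS]big_nat; apply: leq_sum => i /andP[i1 ij].
  by rewrite XM// i1 (leq_trans _ jn).
by rewrite sum_nat_const_nat subn1/= leq_mul2r jn orbT.
Qed.

Lemma bounded_partial_sum (f : nat -> R) j : (j <= n)%N ->
  bounded_rv (fun w => f (S j w)).
Proof.
move=> jn; apply: (bounded_rv_nat (N := (n * M)%N)).
  exact: partial_sum_measurable.
by move=> w; exact: partial_sum_le.
Qed.

Lemma bounded_summand (f : nat -> R) j : (1 <= j <= n)%N ->
  bounded_rv (fun w => f (X j w)).
Proof.
move=> jn; apply: (bounded_rv_nat (N := M)) => [|w].
  exact: measurable_funPT.
exact: XM.
Qed.

(** Skipping [X k] leaves the gap of two indices between [k.-1] and [k.+1] that 1-dependence asks
    for. *)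
Lemma partial_sum_indep (f g : nat -> R) k : (k < n)%N ->
  \int[P]_w (f (S k.-1 w) * g (X k.+1 w)) =
  \int[P]_w f (S k.-1 w) * \int[P]_w g (X k.+1 w).
Proof.
move=> kn.
have bg : bounded_rv (fun w => g (X k.+1 w)) by exact: bounded_summand.
(* For [k <= 1] there is no first block; the sum is empty and hence constant. *)
have [k1|k1] := leqP k 1.
  have S0 w : S k.-1 w = 0%N.
    by rewrite /S big_geq//; case: k k1 {kn bg} => [|[]].
  under eq_Rintegral do rewrite S0.
  under [X in _ = X * _]eq_Rintegral do rewrite S0.
  by rewrite RintegralZl ?Rintegral_prob_cst//; exact: bounded_rv_integrable.
apply: (Rintegral_indep (N := (n * M)%N)).
- exact: partial_sum_measurable.
- exact: measurable_funPT.
- by move=> w; apply: partial_sum_le; rewrite (leq_trans (leq_pred _))// ltnW.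
- by move=> w; rewrite (leq_trans (XM _ _))// leq_pmull// (leq_ltn_trans _ kn).
move=> a b.
have k0 : (0 < k)%N by rewrite ltnW.
apply: (Xdep _ (p := k.-1) (q := k.+1)).
- by rewrite (leq_ltn_trans _ kn).
- by rewrite -ltnS prednK.
- by rewrite prednK.
- by [].
- by move: k0; case: (k) => // i _; rewrite -[i.+2]addn2 addKn.
- apply: (sigma_family_sum (r := index_iota 1 k.-1.+1)) => i.
  by rewrite mem_index_iota ltnS.
(* A single variable is treated as a one-term sum. *)
- suff -> : X k.+1 @^-1` [set b] =
      [set w | (\sum_(i <- [:: k.+1]) X i w)%N = b].
    by apply: sigma_family_sum => i; rewrite inE => /eqP ->; rewrite /= ltnSn.
  by under [in RHS]eq_set do rewrite big_seq1.
Qed.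

Lemma summand_ge0 j : 0 <= nu j.
Proof. exact: Rintegral_ge0. Qed.

Lemma partial_sumS j w : S j.+1 w = (S j w + X j.+1 w)%N.
Proof. by rewrite /S big_nat_recr. Qed.

(** * Bound on exponential moments *)

Section exponential_moment.
Context (u : R) (u1 : 1 <= u).

(** Each step multiplies the moment by at most [1 + (u ^+ M) ^+ 2 * nu j.+1], which is below the
    exponential of its second term. One factor [u ^+ M] pays for dropping [X j], the other for
    linearizing [u ^+ X j.+1 w - 1]. *)
Lemma exponential_moment_le j : (j <= n)%N ->
  \int[P]_w (u ^+ S j w) <=
  expR ((u ^+ M) ^+ 2 * \sum_(1 <= i < j.+1) nu i).
Proof.
have u0 : 0 <= u by rewrite (le_trans ler01).
have ux (x : nat) : (x <= M)%N -> u ^+ x - 1 <= u ^+ M * x%:R.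
  case: x => [_|x xM]; first by rewrite expr0 subrr mulr0.
  rewrite lerBlDr (le_trans (ler_weXn2l u1 xM))//.
  rewrite (@le_trans _ _ (u ^+ M * x.+1%:R))// ?lerDl//.
  by rewrite ler_peMr ?exprn_ge0// ler1n.
elim: j => [_|j IH jn].
  under eq_Rintegral do rewrite /S big_geq// expr0.
  by rewrite Rintegral_prob_cst big_geq// mulr0 expR0.
have bS i : (i <= n)%N -> bounded_rv (fun w => u ^+ S i w).
  exact: (bounded_partial_sum (fun x => u ^+ x)).
have bX : bounded_rv (fun w => ((X j.+1 w)%:R : R)).
  by apply: (bounded_summand (fun x => x%:R)).
have j1n : (j.-1 <= n)%N by rewrite (leq_trans (leq_pred _))// ltnW.
have step : \int[P]_w (u ^+ S j.+1 w) <=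
    \int[P]_w (u ^+ S j w) * (1 + (u ^+ M) ^+ 2 * nu j.+1).
  apply: (@le_trans _ _ (\int[P]_w (u ^+ S j w +
      (u ^+ M) ^+ 2 * (u ^+ S j.-1 w * (X j.+1 w)%:R)))).
    apply: le_Rintegral => //.
    - exact/bounded_rv_integrable/bS.
    - apply/bounded_rv_integrable/bounded_rvD; first by apply: bS; exact: ltnW.
      apply: bounded_rvM; first exact: bounded_rv_cst.
      by apply: bounded_rvM => //; exact: bS.
    move=> w _; rewrite partial_sumS exprD -lerBlDl.
    rewrite -{2}[u ^+ S j w]mulr1 -mulrBr.
    (* Passing to [S j.-1] gives independence from [X j.+1]. At [j = 0] the predecessor is 0 itself
       and [u ^+ M >= 1] suffices. *)
    have Sj : u ^+ S j w <= u ^+ S j.-1 w * u ^+ M.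
      case: j jn {IH bX j1n} => [_|j jn /=].
        by rewrite ler_peMr ?exprn_ge0// exprn_ege1.
      rewrite partial_sumS exprD ler_wpM2l ?exprn_ge0// ler_weXn2l//.
      by rewrite XM//= ltnW.
    rewrite (_ : _ ^+ 2 * _ =
      (u ^+ S j.-1 w * u ^+ M) * (u ^+ M * (X j.+1 w)%:R)).
      by rewrite ler_pM ?exprn_ge0 ?subr_ge0 ?exprn_ege1// ux// XM.
    by ring.
  rewrite RintegralD//; last 2 first.
  - by apply/bounded_rv_integrable/bS; exact: ltnW.
  - apply: bounded_rv_integrable.
    apply: bounded_rvM; first exact: bounded_rv_cst.
    by apply: bounded_rvM => //; exact: bS.
  rewrite RintegralZl//; last first.
    by apply: bounded_rv_integrable; apply: bounded_rvM => //; exact: bS.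
  rewrite (partial_sum_indep (fun x => u ^+ x) (fun x => x%:R))//.
  rewrite mulrDr mulr1 lerD2l mulrCA ler_wpM2r//.
    by rewrite mulr_ge0 ?exprn_ge0// summand_ge0.
  (* Back from [S j.-1] to [S j], by monotonicity of powers of [u >= 1]. *)
  apply: le_Rintegral => //.
  - exact/bounded_rv_integrable/bS.
  - by apply/bounded_rv_integrable/bS; exact: ltnW.
  move=> w _; rewrite ler_weXn2l//.
  by case: j {IH jn bX j1n} => // j; rewrite partial_sumS leq_addr.
rewrite (le_trans step)// [in leRHS]big_nat_recr//= [in leRHS]mulrDr expRD.
rewrite ler_pM ?IH ?(ltnW jn)//.
- by apply: Rintegral_ge0 => w _; rewrite exprn_ge0.
- by rewrite addr_ge0// mulr_ge0 ?exprn_ge0// summand_ge0.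
- exact: expR_ge1Dx.
Qed.
End exponential_moment.

(** * Recursion for the generating functions of the partial sums *)

Section pgf.
Context (z : R) (z01 : 0 <= z <= 1).
Let g j : R := \int[P]_w (z ^+ S j w).
Let y j : R := \int[P]_w (1 - z ^+ X j w).

Lemma bounded_pgf j : (j <= n)%N -> bounded_rv (fun w => z ^+ S j w).
Proof. exact: (bounded_partial_sum (fun x => z ^+ x)). Qed.

Lemma bounded_one_sub_pow j : (1 <= j <= n)%N ->
  bounded_rv (fun w => 1 - z ^+ X j w).
Proof. exact: (bounded_summand (fun x => 1 - z ^+ x)). Qed.

Lemma pow_bounds (x : nat) : 0 <= z ^+ x <= 1.
Proof. by case/andP: z01 => z0 z1; rewrite exprn_ge0// exprn_ile1. Qed.

Lemma one_sub_pow_bounds (x : nat) : 0 <= 1 - z ^+ x <= x%:R.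
Proof.
case/andP: (pow_bounds x) => h1 h2; rewrite subr_ge0 h2/=.
case: x h1 {h2} => [|x] h1; first by rewrite expr0 subrr.
by rewrite (@le_trans _ _ 1) ?ler1n// lerBlDr lerDl.
Qed.

Lemma pgf_bounds j : (j <= n)%N -> 0 <= g j <= 1.
Proof.
move=> jn; rewrite Rintegral_ge0/=; last first.
  by move=> w _; case/andP: (pow_bounds (S j w)).
rewrite -[leRHS](Rintegral_prob_cst P) le_Rintegral//.
- exact/bounded_rv_integrable/bounded_pgf.
- exact/bounded_rv_integrable/bounded_rv_cst.
- by move=> w _; case/andP: (pow_bounds (S j w)).
Qed.

Lemma one_sub_pow_mean_bounds j : (1 <= j <= n)%N -> 0 <= y j <= nu j.
Proof.
move=> jn; rewrite Rintegral_ge0/=; last first.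
  by move=> w _; case/andP: (one_sub_pow_bounds (X j w)).
apply: le_Rintegral => //.
- exact/bounded_rv_integrable/bounded_one_sub_pow.
- exact/bounded_rv_integrable/(bounded_summand (fun x => x%:R)).
- by move=> w _; case/andP: (one_sub_pow_bounds (X j w)).
Qed.

(** The upper bound goes through the inverse of [1 + x], as
    [(1 - x + x ^+ 2) * (1 + x) = 1 + x ^+ 3]. *)
Lemma expRN_bounds (x : R) : 0 <= x -> 1 - x <= expR (- x) <= 1 - x + x ^+ 2.
Proof.
move=> x0; apply/andP; split; first exact: expR_ge1Dx.
have x1 : 0 < 1 + x by rewrite ltr_pwDl.
rewrite expRN (@le_trans _ _ (1 + x)^-1)//.
  by rewrite lef_pV2 ?posrE ?expR_gt0// expR_ge1Dx.
rewrite -[leLHS]mul1r ler_pdivrMr//.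
rewrite (_ : _ * _ = 1 + x ^+ 3); last by ring.
by rewrite lerDl exprn_ge0.
Qed.

(** The error is [e2], minus [e1 * y j.+2], minus a quadratic remainder of the exponential. The
    first two are nonnegative and enter with opposite signs, so [nu j.+1 * nu j.+2] is counted only
    once. *)
Lemma pgf_step j : (j.+1 < n)%N ->
  `|g j.+2 - g j.+1 * expR (- y j.+2)| <=
    nu j.+1 * nu j.+2 + nu j.+2 ^+ 2 + `|xcov j.+2|.
Proof.
move=> jn.
have jn0 : (j <= n)%N by rewrite ltnW// ltnW.
have b1 : bounded_rv (fun w => 1 - z ^+ X j.+1 w).
  by apply: bounded_one_sub_pow => /=; exact: ltnW.
have b2 : bounded_rv (fun w => 1 - z ^+ X j.+2 w).
  exact: bounded_one_sub_pow.
have b0 := bounded_pgf jn0.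
pose e1 := \int[P]_w (z ^+ S j w * (1 - z ^+ X j.+1 w)).
pose e2 := \int[P]_w (z ^+ S j w *
                       ((1 - z ^+ X j.+1 w) * (1 - z ^+ X j.+2 w))).
have b01 := bounded_rvM b0 b1.
have b02 := bounded_rvM b0 b2.
have b12 := bounded_rvM b1 b2.
have b012 := bounded_rvM b0 b12.
have g1E : g j.+1 = g j - e1.
  rewrite /g /e1 -RintegralB//; try exact: bounded_rv_integrable.
  by apply: eq_Rintegral => w _; rewrite partial_sumS exprD; ring.
(* From [a * b = a - (1 - b) + (1 - a) * (1 - b)] and the independence of [S j] and [X j.+2]. *)
have g2E : g j.+2 = g j.+1 - g j * y j.+2 + e2.
  rewrite /g /e2 /y.
  have /= <- := partial_sum_indep (fun x => z ^+ x) (fun x => 1 - z ^+ x) jn.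
  have b1' := bounded_pgf (ltnW jn).
  rewrite -RintegralB//; try exact: bounded_rv_integrable.
  rewrite -RintegralD//; try (apply: bounded_rv_integrable => //;
    exact: bounded_rvB).
  by apply: eq_Rintegral => w _; rewrite !partial_sumS !exprD/=; ring.
have e1_le : 0 <= e1 <= y j.+1.
  rewrite Rintegral_ge0/=; last first.
    move=> w _; case/andP: (one_sub_pow_bounds (X j.+1 w)) => *.
    by rewrite mulr_ge0//; case/andP: (pow_bounds (S j w)).
  apply: le_Rintegral => //; try exact: bounded_rv_integrable.
  move=> w _; case/andP: (one_sub_pow_bounds (X j.+1 w)) => *.
  by rewrite ler_piMl//; case/andP: (pow_bounds (S j w)).
(* The upper bound is the mean of the product of the two neighbours. *)
have e2_le : 0 <= e2 <= xcov j.+2 + nu j.+1 * nu j.+2.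
  rewrite Rintegral_ge0/=; last first.
    move=> w _; case/andP: (one_sub_pow_bounds (X j.+1 w)) => *.
    case/andP: (one_sub_pow_bounds (X j.+2 w)) => *.
    by rewrite !mulr_ge0//; case/andP: (pow_bounds (S j w)).
  rewrite subrK; apply: le_Rintegral => //; try exact: bounded_rv_integrable.
    apply: bounded_rv_integrable; apply: bounded_rvM.
      by apply: (bounded_summand (fun x => x%:R)) => /=; exact: ltnW.
    exact: (bounded_summand (fun x => x%:R)).
  move=> w _; case/andP: (one_sub_pow_bounds (X j.+1 w)) => *.
  case/andP: (one_sub_pow_bounds (X j.+2 w)) => * /=.
  rewrite (@le_trans _ _ ((1 - z ^+ X j.+1 w) * (1 - z ^+ X j.+2 w)))//.
    by rewrite ler_piMl ?mulr_ge0//; case/andP: (pow_bounds (S j w)).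
  by rewrite ler_pM.
have /andP[y1 ynu1] : 0 <= y j.+1 <= nu j.+1.
  by apply: one_sub_pow_mean_bounds => /=; exact: ltnW.
have /andP[y2 ynu2] : 0 <= y j.+2 <= nu j.+2 by exact: one_sub_pow_mean_bounds.
have /andP[E1 E2] := expRN_bounds y2.
have /andP[g0 g1] := pgf_bounds (ltnW jn).
case/andP: e1_le e2_le => e10 e1y /andP[e20 e2x].
have h1 : e1 * y j.+2 <= nu j.+1 * nu j.+2.
  by rewrite ler_pM// (le_trans e1y).
have h10 : 0 <= e1 * y j.+2 by rewrite mulr_ge0.
have h2 : g j.+1 * (expR (- y j.+2) - (1 - y j.+2)) <= nu j.+2 ^+ 2.
  rewrite -[leRHS]mul1r.
  have y2nu : y j.+2 ^+ 2 <= nu j.+2 ^+ 2 by rewrite !expr2 ler_pM.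
  by apply: ler_pM; rewrite ?subr_ge0//; lra.
have h20 : 0 <= g j.+1 * (expR (- y j.+2) - (1 - y j.+2)).
  by rewrite mulr_ge0 ?subr_ge0.
have -> : g j.+2 - g j.+1 * expR (- y j.+2) =
    e2 - e1 * y j.+2 - g j.+1 * (expR (- y j.+2) - (1 - y j.+2)).
  rewrite g2E {1}(_ : g j = g j.+1 + e1); first by ring.
  by rewrite g1E subrK.
have h3 := ler_norm (xcov j.+2).
have h4 := normr_ge0 (xcov j.+2).
by rewrite ler_norml; apply/andP; split; lra.
Qed.

Lemma partial_sum0 w : S 0 w = 0%N.
Proof. by rewrite /S big_geq. Qed.

Lemma pgf0 : g 0 = 1.
Proof.
rewrite /g; under eq_Rintegral do rewrite partial_sum0 expr0.
exact: Rintegral_prob_cst.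
Qed.

(** The first summand has no predecessor, so only the quadratic remainder of the exponential
    appears. *)
Lemma pgf_step0 : (0 < n)%N -> `|g 1 - g 0 * expR (- y 1)| <= nu 1 ^+ 2.
Proof.
move=> n0.
have /andP[y1 ynu1] : 0 <= y 1 <= nu 1 by exact: one_sub_pow_mean_bounds.
have /andP[E1 E2] := expRN_bounds y1.
have -> : g 1 = 1 - y 1.
  rewrite -[X in X - _](Rintegral_prob_cst P) /y -RintegralB//.
  - by apply: eq_Rintegral => w _; rewrite partial_sumS partial_sum0; ring.
  - exact/bounded_rv_integrable/bounded_rv_cst.
  - exact/bounded_rv_integrable/bounded_one_sub_pow.
have h : y 1 ^+ 2 <= nu 1 ^+ 2 by rewrite !expr2 ler_pM.
by rewrite pgf0 mul1r ler_norml; apply/andP; split; lra.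
Qed.

(** Earlier errors are multiplied by [expR (- y j.+1) <= 1], so the one-step errors simply add up.
    In each, the two products of means are at most [A * nu j.+1], whence the factor 2. *)
Lemma pgf_expR_le A : (forall j, (1 <= j <= n)%N -> nu j <= A) ->
  `|g n - expR (- \sum_(1 <= j < n.+1) y j)| <=
    2 * A * \sum_(1 <= j < n.+1) nu j + \sum_(2 <= j < n.+1) `|xcov j|.
Proof.
move=> nuA.
suff H j : (j <= n)%N ->
    `|g j - expR (- \sum_(1 <= i < j.+1) y i)| <=
      2 * A * \sum_(1 <= i < j.+1) nu i + \sum_(2 <= i < j.+1) `|xcov i|.
  exact: H.
elim: j => [_|j IH jn].
  by rewrite !big_geq// oppr0 expR0 mulr0 addr0 pgf0 subrr normr0.
have /andP[yj ynuj] : 0 <= y j.+1 <= nu j.+1 by exact: one_sub_pow_mean_bounds.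
have nuj : nu j.+1 <= A by exact: nuA.
have nuA2 : nu j.+1 * nu j.+1 <= A * nu j.+1.
  by rewrite ler_wpM2r// summand_ge0.
(* The covariance sum starts at 2, so the first step adds nothing to it. *)
pose c := if j is 0 then 0 else `|xcov j.+1|.
have covS : \sum_(2 <= i < j.+2) `|xcov i| =
    \sum_(2 <= i < j.+1) `|xcov i| + c.
  rewrite /c; case: (j) => [|i]; last by rewrite big_nat_recr.
  by rewrite !big_geq// addr0.
have step : `|g j.+1 - g j * expR (- y j.+1)| <= 2 * A * nu j.+1 + c.
  rewrite /c; case: j jn {IH yj ynuj c covS} nuj nuA2 => [|j] jn nuj nuA2.
    have := pgf_step0 jn; have := summand_ge0 1; rewrite expr2 => h1 h2.
    have : 0 <= A * nu 1 by rewrite mulr_ge0// (le_trans h1).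
    by lra.
  rewrite (le_trans (pgf_step jn))// lerD2r expr2.
  have : nu j.+1 * nu j.+2 <= A * nu j.+2.
    by rewrite ler_wpM2r ?summand_ge0// nuA//= ltnW.
  by lra.
rewrite big_nat_recr//= opprD expRD [in leRHS]big_nat_recr//= covS.
rewrite (_ : g j.+1 - _ = (g j.+1 - g j * expR (- y j.+1)) +
    (g j - expR (- \sum_(1 <= i < j.+1) y i)) * expR (- y j.+1)); last by ring.
rewrite (le_trans (ler_normD _ _))//.
have E1 : expR (- y j.+1) <= 1 by rewrite -expR0 ler_expR oppr_le0.
have h : `|(g j - expR (- \sum_(1 <= i < j.+1) y i)) * expR (- y j.+1)| <=
    2 * A * \sum_(1 <= i < j.+1) nu i + \sum_(2 <= i < j.+1) `|xcov i|.
  rewrite normrM (ger0_norm (expR_ge0 _)) (le_trans _ (IH (ltnW jn)))//.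
  by rewrite ler_piMr.
by rewrite (le_trans (lerD step h))// mulrDr; lra.
Qed.

(** * Expansion in factorial moments *)

Lemma one_sub_pow_expand L (x : nat) : (x <= L)%N ->
  1 - z ^+ x = \sum_(1 <= m < L.+1)
    - (z - 1) ^+ m * (m`!%:R^-1 * (x ^_ m)%:R).
Proof.
move=> xL.
(* The binomial theorem for [1 + (z - 1)]; the terms with [m > x] vanish, so the range can be the
   same for all [x <= L]. *)
have zx : z ^+ x = \sum_(0 <= m < L.+1) (z - 1) ^+ m * 'C(x, m)%:R.
  rewrite -[in LHS](subrK 1 z) addrC exprDn.
  rewrite -(big_mkord xpredT
    (fun i => (1 ^+ (x - i) * (z - 1) ^+ i) *+ 'C(x, i))).
  rewrite [RHS](big_cat_nat (n := x.+1))//= [X in _ = _ + X]big_nat.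
  rewrite [X in _ = _ + X]big1.
    rewrite addr0; apply: eq_bigr => i _.
    by rewrite expr1n mul1r mulr_natr.
  by move=> i /andP[xi _]; rewrite bin_small// mulr0.
rewrite zx big_nat_recl//= expr0 bin0 mulr1 opprD addrA subrr add0r -sumrN.
rewrite big_add1; apply: eq_bigr => m _; rewrite -mulNr; congr (_ * _).
by rewrite -bin_ffact natrM mulrC mulfK.
Qed.

Lemma one_sub_pow_mean_expand L j : (M <= L)%N -> (1 <= j <= n)%N ->
  \int[P]_w (1 - z ^+ X j w) = - \sum_(1 <= m < L.+1)
    (z - 1) ^+ m * (m`!%:R^-1 * \int[P]_w (X j w ^_ m)%:R).
Proof.
move=> ML jn.
pose F m w : R := - (z - 1) ^+ m * (m`!%:R^-1 * (X j w ^_ m)%:R).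
have bX m : bounded_rv (fun w => ((X j w ^_ m)%:R : R)).
  exact: (bounded_summand (fun x => (x ^_ m)%:R)).
have bF m : bounded_rv (F m).
  do 2! (apply: bounded_rvM; first exact: bounded_rv_cst).
  exact: bX.
transitivity (\int[P]_w (\sum_(1 <= m < L.+1) F m w)).
  apply: eq_Rintegral => w _.
  have xL : (X j w <= L)%N by rewrite (leq_trans (XM _ _)).
  exact: one_sub_pow_expand.
have [_ ->] := Rintegral_sum_seq P (r := index_iota 1 L.+1) (fun m _ => bF m).
rewrite -sumrN; apply: eq_bigr => m _.
rewrite RintegralZl//; last first.
  apply: bounded_rv_integrable; apply: bounded_rvM; first exact: bounded_rv_cst.
  exact: bX.
by rewrite RintegralZl ?mulNr//; exact: bounded_rv_integrable.
Qed.

End pgf.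

(** * Moments, covariances and the law of the sum as real integrals *)

Lemma factorial_momentE m j : (1 <= j <= n)%N ->
  factorial_moment m (X j) = (\int[P]_w (X j w ^_ m)%:R)%:E.
Proof.
move=> jn; rewrite /factorial_moment unlock /Rintegral fineK//.
apply: integrable_fin_num => //.
exact/bounded_rv_integrable/(bounded_summand (fun x => (x ^_ m)%:R)).
Qed.

Lemma natcovE j : (2 <= j <= n)%N -> natcov (X j.-1) (X j) = (xcov j)%:E.
Proof.
case: j => // j /andP[j1 jn].
have b1 : bounded_rv (fun w => ((X j w)%:R : R)).
  by apply: (bounded_summand (fun x => x%:R)); rewrite -ltnS j1 ltnW.
have b2 : bounded_rv (fun w => ((X j.+1 w)%:R : R)).
  exact: (bounded_summand (fun x => x%:R)).
have L f : bounded_rv f -> f \in Lfun P 1.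
  by move=> bf; apply/Lfun1_integrable; exact: bounded_rv_integrable.
have iE f : bounded_rv f -> 'E_P[f]%E = (\int[P]_w f w)%:E.
  move=> bf; rewrite unlock /Rintegral fineK//.
  by apply: integrable_fin_num => //; exact: bounded_rv_integrable.
have b12 := bounded_rvM b1 b2.
by rewrite /natcov covarianceE ?L// !iE// /xcov EFinB EFinM.
Qed.

Lemma partial_sum_law (f : nat -> R) : (forall k, 0 <= f k) ->
  (\sum_(0 <= k <oo) (f k * fine (P [set w | S n w = k]))%:E =
    (\int[P]_w f (S n w))%:E)%E.
Proof.
move=> f0.
(* Bundled as a random variable, the sum has a [distribution], and the series is an integral against
   it. *)
pose Sn : {RV P >-> nat} := HB.pack (S n)
  (isMeasurableFun.Build _ _ _ _ (S n) (partial_sum_measurable n)).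
rewrite /Rintegral fineK; last first.
  apply: integrable_fin_num => //.
  exact/bounded_rv_integrable/bounded_partial_sum.
transitivity (\int[distribution P Sn]_k (f k)%:E)%E.
  rewrite ge0_integral_nat; last by move=> k; rewrite lee_fin.
  apply: eq_eseriesr => k _; rewrite EFinM fineK// fin_num_measure//.
  exact: (measurable_nat_fiber (Y := S n) k (partial_sum_measurable n)).
by rewrite ge0_integral_distribution.
Qed.

Lemma one_sub_pow_mean_sum z L : (M <= L)%N ->
  \sum_(1 <= j < n.+1) \int[P]_w (1 - z ^+ X j w) =
  - \sum_(1 <= m < L.+1) (z - 1) ^+ m *
    (m`!%:R^-1 * \sum_(1 <= j < n.+1) \int[P]_w (X j w ^_ m)%:R).
Proof.
move=> ML.
under eq_big_nat => j jn do rewrite (one_sub_pow_mean_expand z ML jn).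
rewrite sumrN.
rewrite exchange_big/=; congr (- _); apply: eq_bigr => m _.
by rewrite -!mulr_sumr.
Qed.

(** If [x < m], then [x ^_ m] is 0; otherwise [x ^_ m <= x]! <= M[!] and [x ^_ s >= 1]. Thus control
    of order [s] passes to all higher orders. *)
Lemma high_factorial_moment_sum_le s m : (s <= m)%N ->
  0 <= \sum_(1 <= j < n.+1) \int[P]_w ((X j w ^_ m)%:R : R) <=
    M`!%:R * \sum_(1 <= j < n.+1) \int[P]_w (X j w ^_ s)%:R.
Proof.
move=> sm; rewrite sumr_ge0/=; last by move=> j _; exact: Rintegral_ge0.
rewrite mulr_sumr; apply: ler_sum_nat => j /= jn.
have b k : P.-integrable setT (EFin \o (fun w => ((X j w ^_ k)%:R : R))).
  exact/bounded_rv_integrable/(bounded_summand (fun x => (x ^_ k)%:R)).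
rewrite -RintegralZl//.
apply: le_Rintegral => //.
  apply: bounded_rv_integrable; apply: bounded_rvM; first exact: bounded_rv_cst.
  exact: (bounded_summand (fun x => ((x ^_ s)%:R : R))).
move=> w _; rewrite -natrM ler_nat.
have [mx|xm] := leqP m (X j w); last by rewrite ffact_small.
rewrite -[leqLHS]muln1 leq_mul ?ffact_gt0 ?(leq_trans sm)//.
have xM := XM w jn.
rewrite (@leq_trans (X j w)`!)//; last exact: leq_fact.
by rewrite -(ffact_fact mx) leq_pmulr// fact_gt0.
Qed.

End one_dependent_sums.

(** * Passage to real limits and the binomial transform *)

Lemma cvg_EFin_inv (R : realType) (F : nat -> \bar R) (f : nat -> R) (l : R) :
  (forall n, F n = (f n)%:E) -> F n @[n --> \oo] --> l%:E ->
  f n @[n --> \oo] --> l.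
Proof. by move=> FE /fine_cvg; under eq_fun do rewrite /= FE. Qed.

Lemma prob_nat_series (R : realType) (mu : probability nat R) (f : nat -> R) :
  (forall k, 0 <= f k) ->
  (\sum_(0 <= k <oo) (f k * fine (mu [set k]))%:E = \int[mu]_k (f k)%:E)%E.
Proof.
move=> f0; rewrite ge0_integral_nat; last by move=> k; rewrite lee_fin.
by apply: eq_eseriesr => k _; rewrite EFinM fineK// fin_num_measure.
Qed.

(* The right-hand side is -log of the pgf of CP(s, lam) at z, the inner sums on
   the left are the limits of the binomial moments. *)
Lemma binomial_transform (R : realType) (s L : nat) (lam : nat -> R) (z : R) :
  (s <= L)%N ->
  - \sum_(1 <= m < L.+1) (z - 1) ^+ m *
      \sum_(m <= l < s.+1) 'C(l, m)%:R * lam l =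
  \sum_(1 <= l < s.+1) lam l * (1 - z ^+ l).
Proof.
move=> sL.
transitivity (\sum_(1 <= l < s.+1) \sum_(1 <= m < L.+1)
    lam l * (- (z - 1) ^+ m * (m`!%:R^-1 * (l ^_ m)%:R))).
  rewrite exchange_big/= -sumrN; apply: eq_big_nat => m /andP[m1 _].
  rewrite (big_nat_widenl m 1)// big_mkcond -mulNr mulr_sumr.
  apply: eq_bigr => l _; have [ml|lm] := leqP m l.
    by rewrite -bin_ffact natrM [_ * m`!%:R]mulrC mulKf//=; ring.
  by rewrite ffact_small//= !mulr0.
apply: eq_big_nat => l /andP[_ ls].
by rewrite -mulr_sumr -one_sub_pow_expand// (leq_trans _ sL).
Qed.

(** * Convergence of the weighted distance *)

Theorem theorem2p1 (R : realType) (C0 h : R) (s : nat) (lam : nat -> R)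
    (d : nat -> measure_display) (T : forall n, measurableType (d n))
    (P : forall n, probability (T n) R)
    (X : forall n, nat -> {RV (P n) >-> nat})
    (C0_ge1 : 1 <= C0) (h_ge0 : 0 <= h) (s_ge1 : (1 <= s)%N)
    (lam_ge0 : forall j : nat, (1 <= j <= s)%N -> 0 <= lam j)
    (X_le_C0 : forall n i (w : T n), (1 <= i <= n)%N -> (X n i w)%:R <= C0)
    (X_1dep : forall n, (1 <= n)%N -> one_dependent n (X n))
    (nu1_max : ((\big[maxe/0]_(1 <= j < n.+1) factorial_moment 1 (X n j))%E
       @[n --> \oo] --> 0%E))
    (nu_sum : forall m : nat, (1 <= m <= s)%N ->
       ((m`!%:R^-1)%:E * \sum_(1 <= j < n.+1) factorial_moment m (X n j))%E
       @[n --> \oo] --> (\sum_(m <= l < s.+1) 'C(l, m)%:R * lam l)%:E)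
    (nu_top : (\sum_(1 <= j < n.+1) factorial_moment s.+1 (X n j))%E
       @[n --> \oo] --> 0%E)
    (cov_sum : (\sum_(2 <= j < n.+1) `|natcov (X n j.-1) (X n j)|)%E
       @[n --> \oo] --> 0%E) :
  (\sum_(0 <= k <oo) (expR (h * k%:R))%:E *
     `|P n [set w | (\sum_(1 <= i < n.+1) X n i w)%N = k]
       - CP s lam [set k]|)%E
  @[n --> \oo] --> 0%E.
Proof.
(* An integer bound on the summands that does not depend on [n]. *)
pose M := Num.bound C0.
have XM n i w : (1 <= i <= n)%N -> (X n i w <= M)%N.
  move=> ni; rewrite -(ler_nat R) (le_trans (X_le_C0 _ _ _ ni))//.
  by rewrite ltW// archi_boundP// (le_trans ler01).
pose S n w := (\sum_(1 <= i < n.+1) X n i w)%N.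
pose nu m n j : R := \int[P n]_w (X n j w ^_ m)%:R.
pose xcov n j : R := \int[P n]_w ((X n j.-1 w)%:R * (X n j w)%:R) -
  \int[P n]_w (X n j.-1 w)%:R * \int[P n]_w (X n j w)%:R.
pose A n : R := \big[Num.max/0]_(1 <= j < n.+1) nu 1 n j.
have fmE m n j : (1 <= j < n.+1)%N ->
    factorial_moment m (X n j) = (nu m n j)%:E.
  exact: (factorial_momentE (XM n)).
have nu1E n j : nu 1 n j = \int[P n]_w (X n j w)%:R.
  by apply: eq_Rintegral => w _; rewrite ffactn1.
have A0 : A n @[n --> \oo] --> (0 : R).
  apply: cvg_EFin_inv nu1_max => n.
  by under eq_big_nat => j jn do rewrite fmE//; rewrite EFin_bigmax.
have nuA n j : (1 <= j <= n)%N -> \int[P n]_w (X n j w)%:R <= A n.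
  move=> jn; rewrite -nu1E /A.
  by apply: le_bigmax_seq => //; rewrite mem_index_iota.
have C_cvg : \sum_(2 <= j < n.+1) `|xcov n j| @[n --> \oo] --> (0 : R).
  apply: cvg_EFin_inv cov_sum => n.
  under eq_big_nat => j jn do rewrite (natcovE (XM n) jn)//=.
  by rewrite sumEFin.
have nu_cvg m : (1 <= m)%N ->
    m`!%:R^-1 * \sum_(1 <= j < n.+1) nu m n j @[n --> \oo] -->
    \sum_(m <= l < s.+1) 'C(l, m)%:R * lam l.
  move=> m1; have [ms|sm] := leqP m s.
    apply: cvg_EFin_inv (nu_sum m _) => [n|]; last by rewrite m1.
    by under eq_big_nat => j jn do rewrite fmE//; rewrite sumEFin EFinM.
  (* For [m > s] the limit is an empty sum, and order [m] is dominated by order [s.+1]. *)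
  have top : \sum_(1 <= j < n.+1) nu s.+1 n j @[n --> \oo] --> (0 : R).
    apply: cvg_EFin_inv nu_top => n.
    by under eq_big_nat => j jn do rewrite fmE//; rewrite sumEFin.
  rewrite big_geq// -[X in _ --> X](mulr0 (m`!%:R^-1)).
  apply: cvgM; first exact: cvg_cst.
  apply: (squeeze_cvgr (f := fun=> 0)
    (h := fun n => M`!%:R * \sum_(1 <= j < n.+1) nu s.+1 n j)).
  - by near=> n; exact: (high_factorial_moment_sum_le (XM n)).
  - exact: cvg_cst.
  - by rewrite -[X in _ --> X](mulr0 M`!%:R); apply: cvgM => //; exact: cvg_cst.
pose ell : R := \sum_(1 <= l < s.+1) 'C(l, 1)%:R * lam l.
have B_cvg : \sum_(1 <= j < n.+1) \int[P n]_w (X n j w)%:R @[n --> \oo] --> ell.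
  have := nu_cvg 1%N isT; rewrite factS fact0 muln1 invr1.
  by under eq_fun do [rewrite mul1r; under eq_bigr do rewrite nu1E].
(* One truncation order at which the expansions are exact both for the summands, bounded by [M], and
   for the jumps of [CP], bounded by [s]. *)
pose L := maxn M s.
have pgf_cvg z : 0 < z < 1 -> \int[P n]_w (z ^+ S n w) @[n --> \oo] -->
    expR (\sum_(1 <= l < s.+1) lam l * (z ^+ l - 1)).
  move=> /andP[z0 z1].
  pose Y n := \sum_(1 <= j < n.+1) \int[P n]_w (1 - z ^+ X n j w).
  have Y_cvg : expR (- Y n) @[n --> \oo] -->
      expR (\sum_(1 <= l < s.+1) lam l * (z ^+ l - 1)).
    apply: continuous_cvg; first exact: continuous_expR.
    rewrite (_ : \sum_(_ <= l < _) _ = - - \sum_(1 <= m < L.+1) (z - 1) ^+ m *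
      \sum_(m <= l < s.+1) 'C(l, m)%:R * lam l); last first.
      rewrite binomial_transform ?leq_maxr// -sumrN.
      by apply: eq_bigr => l _; rewrite -mulrN opprB.
    apply: cvgN; rewrite /Y.
    under eq_fun do rewrite (one_sub_pow_mean_sum (XM _) z (leq_maxl M s)).
    apply: cvgN; apply: (cvg_sum_nat (f := fun m n => (z - 1) ^+ m *
      (m`!%:R^-1 * \sum_(1 <= j < n.+1) nu m n j))) => m /andP[m1 _].
    by apply: cvgM; [exact: cvg_cst|exact: nu_cvg].
  (* The largest mean tends to 0 while the sum of the means converges to [ell]. *)
  have err_cvg : 2 * A n * \sum_(1 <= j < n.+1) \int[P n]_w (X n j w)%:R +
      \sum_(2 <= j < n.+1) `|xcov n j| @[n --> \oo] --> (0 : R).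
    rewrite -[X in _ --> X]addr0; apply: cvgD => //.
    rewrite -[X in _ --> X](mul0r ell); apply: cvgM => //.
    rewrite -[X in _ --> X](mulr0 2); apply: cvgM => //; exact: cvg_cst.
  rewrite -[X in _ --> X]add0r.
  rewrite (_ : (fun n => _) = (fun n =>
    (\int[P n]_w (z ^+ S n w) - expR (- Y n)) + expR (- Y n))); last first.
    by apply/funext => n; rewrite subrK.
  apply: cvgD => //.
  apply/cvgr0Pnorm_le => e e0; near=> n.
  have err : 2 * A n * \sum_(1 <= j < n.+1) \int[P n]_w (X n j w)%:R +
      \sum_(2 <= j < n.+1) `|xcov n j| <= e.
    rewrite (le_trans (ler_norm _))//; near: n.
    by move/cvgr0Pnorm_le : err_cvg; exact.
  apply: le_trans err; apply: (pgf_expR_le (XM n) (X_1dep n)) => //.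
    by rewrite !ltW.
  exact: nuA.
pose p n k := fine (P n [set w | S n w = k]).
pose q k := fine (CP s lam [set k]).
have p0 n k : 0 <= p n k by rewrite fine_ge0.
have q0 k : 0 <= q k by rewrite fine_ge0.
have mS n k : measurable [set w | S n w = k].
  exact: (measurable_nat_fiber (Y := S n) k (partial_sum_measurable (X n) n)).
have p_pgf n (z : R) : 0 <= z -> (\sum_(0 <= k <oo) (z ^+ k * p n k)%:E)%E =
    (\int[P n]_w (z ^+ S n w))%:E.
  by move=> z0; apply: (partial_sum_law (XM n)) => k; rewrite exprn_ge0.
have q_pgf (z : R) : 0 <= z -> (\sum_(0 <= k <oo) (z ^+ k * q k)%:E)%E =
    (expR (\sum_(1 <= l < s.+1) lam l * (z ^+ l - 1)))%:E.
  move=> z0; rewrite -CP_pgf//; apply: prob_nat_series => k.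
  by rewrite exprn_ge0.
have mass_cvg : forall k, p n k @[n --> \oo] --> q k.
  apply: (pgf_cvg_mass (g := fun n z => \int[P n]_w (z ^+ S n w))
    _ _ _ _ _ _ pgf_cvg).
  - by [].
  - by [].
  (* The total mass is the generating function at 1. *)
  - move=> n; have := p_pgf n 1 ler01.
    under eq_eseriesr do rewrite expr1n mul1r.
    move=> ->; under eq_Rintegral do rewrite expr1n.
    by rewrite Rintegral_prob_cst.
  - have := q_pgf 1 ler01.
    under eq_eseriesr do rewrite expr1n mul1r.
    by move=> ->; rewrite big1 ?expR0// => l _; rewrite expr1n subrr mulr0.
  - by move=> n z /andP[z0 _]; exact/p_pgf/ltW.
  - by move=> z /andP[z0 _]; exact/q_pgf/ltW.
pose u := expR h.
have u0 : 0 <= u by exact: expR_ge0.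
have u1 : 1 <= 2 * u.
  by rewrite (@le_trans _ _ 2) ?ler1n// ler_peMr// -expR0 ler_expR.
(* Moments at base [2 * u]: the first entry bounds those of the sums once their means add up to at
   most [ell + 1], the second is the exact value for [CP]. *)
pose B := Num.max (expR (((2 * u) ^+ M) ^+ 2 * (ell + 1)))
  (expR (\sum_(1 <= l < s.+1) lam l * ((2 * u) ^+ l - 1))).
have := weighted_mass_cvg (B := B) u0 p0 q0 _ _ mass_cvg.
have -> : (fun n => \sum_(0 <= i <oo) (u ^+ i * `|p n i - q i|)%:E)%E =
  (fun n => \sum_(0 <= k <oo) (expR (h * k%:R))%:E *
     `|P n [set w | (\sum_(1 <= i < n.+1) X n i w)%N = k]
       - CP s lam [set k]|)%E.
  apply/funext => n; apply: eq_eseriesr => k _.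
  by rewrite expRM_natr EFinM -abse_EFin EFinB /p /q !fineK ?fin_num_measure.
apply.
- have B_near : \forall n \near \oo,
      \sum_(1 <= j < n.+1) \int[P n]_w (X n j w)%:R <= ell + 1.
    by apply: (cvgr_le _ B_cvg); rewrite ltrDl.
  near=> n; rewrite p_pgf ?(le_trans ler01)// lee_fin.
  rewrite (le_trans (exponential_moment_le (XM n) (X_1dep n) u1 (leqnn n)))//.
  rewrite le_max ler_expR ler_wpM2l ?exprn_ge0 ?(le_trans ler01)//.
  by near: n.
- by rewrite q_pgf ?(le_trans ler01)// lee_fin le_max lexx orbT.
Unshelve. all: by end_near. Qed.
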